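(* Let $m=\begin{pmatrix}0&1\\0&0\end{pmatrix}$ and let $\psi$ be a character of $U=Z_G(m)$. Let $x\in\kappa$ and let $r$ be an integer satisfying $0\le r\le-\mathfrak{c}(\psi)$. Then for every $f\in V_{m,\psi}^{K_\epsilon}$: $$(T_xf)(t_{\varpi^{-r}})=q\cdot f(t_{\varpi^{-(r-1)}})+f(t_{\varpi^{-(r+1)}}).$$
   Context: $F$ is a non-Archimedean local field of characteristic different from $2$, $\mathcal{O}$ its ring of integers, $\varpi$ a generator of the maximal ideal, $v$ the valuation of $F$, $\kappa=\mathcal{O}/\varpi\mathcal{O}$, $q=|\kappa|$. For a ring $A$, $A_\epsilon:=A[\epsilon]/(\epsilon^2)$. Put $G=\mathrm{PGL}_2(F)$, $G_\epsilon=\mathrm{PGL}_2(F_\epsilon)$, $K_\epsilon=\mathrm{PGL}_2(\mathcal{O}_\epsilon)$, $\mathfrak{g}=\mathfrak{sl}_2(F)$. Elements of $\mathrm{PGL}_2$ are written as matrices in $\mathrm{GL}_2$; $u_x:=\begin{pmatrix}1&x\\0&1\end{pmatrix}$, $t_x:=\begin{pmatrix}x&0\\0&1\end{pmatrix}$. One has $G_\epsilon=(1+\epsilon\mathfrak{g})\rtimes G$. For $x\in\kappa$ with a lift $\tilde x\in\mathcal{O}$, let $g_x=\begin{pmatrix}\varpi+\epsilon\tilde x&0\\0&1\end{pmatrix}\in G_\epsilon$; the double coset $K_\epsilon g_xK_\epsilon$ does not depend on the lift. $T_x:=q^{-1}\,\mathrm{ch}_{K_\epsilon g_xK_\epsilon}$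 in the Hecke algebra of $(G_\epsilon,K_\epsilon)$ (Haar measure with $\mathrm{vol}(K_\epsilon)=1$); on the $K_\epsilon$-invariants $V^{K_\epsilon}$ of a smooth representation $V$ of $G_\epsilon$ it acts by $T_xv=q^{-1}\sum_{gK_\epsilon\subset K_\epsilon g_xK_\epsilon}gv$. $U=\{u_s:s\in F\}\subset G$ and, for $\ell\in\mathbb{Z}$, $U_{(\ell)}=\{u_s:s\in F,\ v(s)\ge\ell\}$. A character is a smooth homomorphism to $\mathbb{C}^\times$. For a character $\psi$ of $U$, $\mathfrak{c}(\psi)$ is the smallest $\ell\in\mathbb{Z}$ for which $\psi$ is trivial on $U_{(\ell)}$, with $\mathfrak{c}(\psi)=-\infty$ if $\psi=1$. Fix an additive character $\psi_0:F\to\mathrm{U}(1)$ with $\{x\in F:\psi_0|_{x\mathcal{O}}=1\}=\mathcal{O}$, and for $m\in\mathfrak{g}$ let $\psi_m(m')=\psi_0(\mathrm{tr}(mm'))$. $V_{m,\psi}$ is the space of smooth functions $f:G_\epsilon\to\mathbb{C}$ such that $f((1+\epsilon m')g)=\psi_m(m')f(g)$ for $m'\in\mathfrak{g}$, $g\in G$; $f(ug)=\psi(u)f(g)$ for $u\in U$, $g\in G$; and the support of $f|_G$ is compact modulo left translation by $U$. $G_\epsilon$ acts by right translation. *)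

(* Defs.v *)
From HB Require Import structures.
From mathcomp Require Import all_boot all_order all_algebra.
From mathcomp Require Import finmap complex.
From mathcomp Require Import all_classical all_reals topology.

Set Implicit Arguments.
Unset Strict Implicit.
Unset Printing Implicit Defensive.

Import Order.TTheory GRing.Theory Num.Theory.

Local Open Scope classical_set_scope.
Local Open Scope quotient_scope.
Local Open Scope ring_scope.

#[short(type="topComUnitRingType")]
HB.structure Definition TopComUnitRing :=
  {A of GRing.ComUnitRing A & Topological A}.

(* A field, complete for the uniform structure of a normalized discrete
   valuation [valuation], with [valuation 0 = +oo]. *)
HB.mixin Record isDiscretelyValued F of GRing.Field F & Complete F := {
  valuation : F -> \bar int;
  valE0 : forall x : F, valuation x = +oo%E <-> x = 0;
  val_fin : forall x : F, x != 0 -> valuation x \is a fin_num;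
  valM : forall x y : F, valuation (x * y) = (valuation x + valuation y)%E;
  valD : forall x y : F,
    (mine (valuation x) (valuation y) <= valuation (x + y)%R)%E;
  val_norm : exists x : F, valuation x = 1%:E;
  val_entourage : forall A : set (F * F),
    entourage A <->
    exists n : int, forall x y : F, (n%:E <= valuation (y - x)%R)%E -> A (x, y)
}.

#[short(type="dvFieldType")]
HB.structure Definition DVField :=
  {F of GRing.Field F & Complete F & isDiscretelyValued F}.

Arguments valuation {s} x : rename.

Section Valuation.
Variable F : dvFieldType.
Implicit Types x y : F.

Local Notation v := valuation.

Lemma val0 : v (0 : F) = +oo%E. Proof. exact/valE0. Qed.

Lemma val1 : v (1 : F) = 0%E.
Proof.
have := valM (1 : F) 1; rewrite mulr1.
have /fineK <- : v (1 : F) \is a fin_num by apply/val_fin/oner_neq0.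
by rewrite -EFinD => -[] /eqP; rewrite -subr_eq subrr => /eqP <-.
Qed.

Lemma valN x : v (- x) = v x.
Proof.
suff h : v (-1 : F) = 0%E by rewrite -mulN1r valM h add0e.
have := valM (-1 : F) (-1); rewrite mulrNN mulr1 val1.
have /fineK <- : v (-1 : F) \is a fin_num.
  by apply/val_fin; rewrite oppr_eq0 oner_neq0.
by rewrite -EFinD => -[] /eqP; rewrite eq_sym -mulr2n mulrn_eq0 /= => /eqP ->.
Qed.

Lemma valV_int x : v x = 0%E -> v x^-1 = 0%E.
Proof.
have [->|x0] := eqVneq x 0; first by rewrite invr0.
by move=> vx; have := valM x x^-1; rewrite divff // val1 vx add0e.
Qed.

Definition integral : {pred F} := fun x => (0 <= v x)%E.

Lemma integral_subring : subring_closed integral.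
Proof.
split=> [|x y xO yO|x y xO yO]; rewrite unfold_in.
- by rewrite val1.
- apply: le_trans (valD _ _); rewrite valN.
  by rewrite le_min; apply/andP; split.
- by rewrite valM adde_ge0.
Qed.
HB.instance Definition _ := GRing.isSubringClosed.Build F integral
  integral_subring.

Definition integers := {x : F | x \in integral}.
HB.instance Definition _ := SubChoice.on integers.
HB.instance Definition _ := [SubChoice_isSubComNzRing of integers by <:].

Lemma integersP (x : integers) : (0 <= v (\val x))%E.
Proof. exact: (valP x). Qed.

Fact inv_integral (x : integers) :
  v (\val x) = 0%E -> (\val x)^-1 \in integral.
Proof. by move=> /valV_int e; rewrite unfold_in e. Qed.

Definition integers_unit : pred integers := fun x : integers => v (\val x) == 0%E.

Definition integers_inv (x : integers) : integers :=
  if insub (\val x)^-1 is Some y then if integers_unit x then y else x else x.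

Fact integers_mulVr : {in integers_unit, left_inverse 1 integers_inv *%R}.
Proof.
move=> x; rewrite unfold_in => /[dup] ux /eqP vx; apply: val_inj.
rewrite /integers_inv insubT ?inv_integral // => yO; rewrite /integers_unit ux /=.
by rewrite mulVf //; apply/eqP => e; move: vx; rewrite [\val x]e val0.
Qed.

Fact integers_unitP (x y : integers) : y * x = 1 -> integers_unit x.
Proof.
move=> /(congr1 (fun z => v (\val z))); rewrite /= valM val1 /integers_unit.
move=> h; rewrite eq_le integersP andbT -h.
by rewrite -{1}[v (\val x)]add0e; apply: leeD2r; exact: integersP.
Qed.

Fact integers_invr_out : {in [predC integers_unit], integers_inv =1 id}.
Proof.
move=> x /negbTE nx; rewrite /integers_inv.
by rewrite [integers_unit x]nx; case: insub.
Qed.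

HB.instance Definition _ := GRing.ComNzRing_hasMulInverse.Build integers
  integers_mulVr integers_unitP integers_invr_out.

Definition max_ideal : {pred integers} := fun x : integers => (0 < v (\val x))%E.

Fact max_ideal_idealr : idealr_closed max_ideal.
Proof.
split; rewrite ?unfold_in /= ?val0 ?val1 ?ltxx // => a x y.
rewrite !unfold_in /= => x0 y0; apply: lt_le_trans (valD _ _).
rewrite lt_min y0 andbT valM; apply: lt_le_trans x0 _.
by rewrite -{1}[v (\val x)]add0e; apply: leeD2r; exact: integersP.
Qed.
HB.instance Definition _ := isIdealr.Build integers max_ideal max_ideal_idealr.

Definition residue_field := {ideal_quot max_ideal}.
HB.instance Definition _ := GRing.ComNzRing.on residue_field.
HB.instance Definition _ := Quotient.on residue_field.

Definition uniformizer (pi : integers) : Prop :=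
  [set x | x \in max_ideal] = [set pi * y | y in [set: integers]].

End Valuation.

Arguments integral {F}.
Arguments max_ideal {F}.

HB.mixin Record isLocal F of DVField F := {
  residue_finite : finite_set [set: residue_field F]
}.

#[short(type="localFieldType")]
HB.structure Definition LocalField := {F of DVField F & isLocal F}.

Section DualNumbers.
Variable A : Type.
(* [(a, b)] stands for [a + b eps]. *)
Definition dual : Type := (A * A)%type.
End DualNumbers.

HB.instance Definition _ (A : choiceType) := Choice.copy (dual A) (A * A)%type.
HB.instance Definition _ (A : zmodType) :=
  GRing.Zmodule.copy (dual A) (A * A)%type.
HB.instance Definition _ (A : topologicalType) :=
  Topological.copy (dual A) (A * A)%type.

Section DualRing.
Variable A : comNzRingType.
Implicit Types x y : dual A.

Definition dual_one : dual A := (1, 0).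
Definition dual_mul x y : dual A := (x.1 * y.1, x.1 * y.2 + x.2 * y.1).

Fact dual_mulA : associative dual_mul.
Proof.
move=> [a b] [c d] [e f]; rewrite /dual_mul /= !mulrDr !mulrDl !mulrA.
by rewrite addrA.
Qed.
Fact dual_mulC : commutative dual_mul.
Proof.
move=> [a b] [c d]; rewrite /dual_mul /= [c * a]mulrC [c * b]mulrC.
by rewrite [d * a]mulrC addrC.
Qed.
Fact dual_mul1 : left_id dual_one dual_mul.
Proof. by move=> [a b]; rewrite /dual_mul /= !mul1r mul0r addr0. Qed.
Fact dual_mulDl : left_distributive dual_mul +%R.
Proof.
move=> [a b] [c d] [e f]; rewrite /dual_mul /= !mulrDl; congr (_, _).
by rewrite addrACA.
Qed.
Fact dual_one_neq0 : dual_one != 0.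
Proof. by apply/eqP => -[] /eqP; rewrite oner_eq0. Qed.

HB.instance Definition _ := GRing.Zmodule_isComNzRing.Build (dual A)
  dual_mulA dual_mulC dual_mul1 dual_mulDl dual_one_neq0.

Definition eps : dual A := (0, 1).
Definition dual_in (a : A) : dual A := (a, 0).

Fact dual_in_zmod : zmod_morphism dual_in.
Proof. by move=> a b; congr (_, _); rewrite /= subr0. Qed.
Fact dual_in_monoid : monoid_morphism dual_in.
Proof.
by split=> // a b; congr (_, _); rewrite /= mulr0 mul0r addr0.
Qed.
HB.instance Definition _ := GRing.isZmodMorphism.Build A (dual A) dual_in
  dual_in_zmod.
HB.instance Definition _ := GRing.isMonoidMorphism.Build A (dual A) dual_in
  dual_in_monoid.

Lemma dualE x : x = dual_in x.1 + eps * dual_in x.2.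
Proof.
case: x => a b; congr (_, _);
  by rewrite /= ?mul0r ?mul1r ?add0r ?addr0.
Qed.

Lemma eps_sqr : eps ^+ 2 = 0.
Proof. by rewrite expr2; congr (_, _); rewrite /= ?mul0r ?mulr0 ?addr0. Qed.

End DualRing.

Arguments eps {A}.

Section DualMap.
Variables (A B : comNzRingType) (phi : {rmorphism A -> B}).

Definition dual_map (x : dual A) : dual B := (phi x.1, phi x.2).

Fact dual_map_zmod : zmod_morphism dual_map.
Proof. by move=> x y; congr (_, _); rewrite /= rmorphB. Qed.
Fact dual_map_monoid : monoid_morphism dual_map.
Proof.
split=> [|x y]; congr (_, _); rewrite /= ?rmorph1 ?rmorph0 ?rmorphM //.
by rewrite rmorphD !rmorphM.
Qed.
HB.instance Definition _ := GRing.isZmodMorphism.Build (dual A) (dual B)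
  dual_map dual_map_zmod.
HB.instance Definition _ := GRing.isMonoidMorphism.Build (dual A) (dual B)
  dual_map dual_map_monoid.
End DualMap.

Section DualUnit.
Variable A : comUnitRingType.
Implicit Types x y : dual A.

Definition dual_unit : pred (dual A) := fun x => x.1 \is a GRing.unit.
Definition dual_inv x : dual A :=
  if dual_unit x then (x.1^-1, - (x.2 * x.1 ^- 2)) else x.

Fact dual_mulVr : {in dual_unit, left_inverse 1 dual_inv *%R}.
Proof.
move=> [a b] ua; rewrite /dual_inv ifT //.
move: ua; rewrite unfold_in /dual_unit /= => ua.
congr (_, _); rewrite /= ?mulVr //.
by rewrite mulNr -mulrA expr2 invrM // mulrVK // mulrC subrr.
Qed.

Fact dual_unitP x y : y * x = 1 -> dual_unit x.
Proof.
move=> /(congr1 (@fst A A)) /= h; apply/unitrP; exists y.1; split=> //.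
by rewrite mulrC.
Qed.

Fact dual_invr_out : {in [predC dual_unit], dual_inv =1 id}.
Proof. by move=> x nx; rewrite /dual_inv ifN. Qed.

HB.instance Definition _ := GRing.ComNzRing_hasMulInverse.Build (dual A)
  dual_mulVr dual_unitP dual_invr_out.
End DualUnit.

HB.instance Definition _ (A : topComUnitRingType) := Topological.on (dual A).

Section PGL2.
Variable A : comUnitRingType.

Definition GL2 : Type := {M : 'M[A]_2 | M \in unitmx}.
HB.instance Definition _ := SubChoice.on GL2.

Definition GL2_one : GL2 := Sub 1%:M (unitmx1 A 2).

Definition scalar_rel : rel GL2 := fun M N =>
  `[< exists2 c : A, c \is a GRing.unit & \val M = c *: \val N >].

Fact scalar_refl : reflexive scalar_rel.
Proof. by move=> M; apply/asboolP; exists 1; rewrite ?unitr1 ?scale1r. Qed.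
Fact scalar_trans : transitive scalar_rel.
Proof.
move=> N M P /asboolP[c uc e] /asboolP[d ud e']; apply/asboolP.
by exists (c * d); rewrite ?unitrM ?uc // e e' scalerA.
Qed.
Fact scalar_imp M N : scalar_rel M N -> scalar_rel N M.
Proof.
move=> /asboolP[c uc e]; apply/asboolP; exists c^-1; rewrite ?unitrV //.
by rewrite e scalerA mulVr // scale1r.
Qed.
Fact scalar_sym : symmetric scalar_rel.
Proof. by move=> M N; apply/idP/idP => /scalar_imp. Qed.

Canonical scalar_equiv := EquivRel scalar_rel scalar_refl scalar_sym
  scalar_trans.

Definition PGL2 : Type := {eq_quot scalar_rel}.
HB.instance Definition _ := Choice.on PGL2.
HB.instance Definition _ := EqQuotient.on PGL2.

(* The class of [M] when [M] is invertible, and 1 otherwise. *)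
Definition pgl (M : 'M[A]_2) : PGL2 := \pi_PGL2 (insubd GL2_one M).

Definition mat (g : PGL2) : 'M[A]_2 := \val (repr g).

Lemma mat_unit g : mat g \in unitmx. Proof. exact: (valP (repr g)). Qed.

Lemma matK g : pgl (mat g) = g.
Proof. by rewrite /pgl /mat valKd reprK. Qed.

Lemma pglP (M N : 'M[A]_2) : M \in unitmx -> N \in unitmx ->
  pgl M = pgl N <-> exists2 c : A, c \is a GRing.unit & M = c *: N.
Proof.
move=> uM uN; rewrite /pgl; split.
  by move=> /eqmodP /asboolP; rewrite !insubdK.
by move=> h; apply/eqmodP/asboolP; rewrite !insubdK.
Qed.

Lemma mat_pgl M : M \in unitmx ->
  exists2 c : A, c \is a GRing.unit & mat (pgl M) = c *: M.
Proof. by move=> uM; apply/pglP; rewrite ?mat_unit ?matK. Qed.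

Definition PGL2_one : PGL2 := pgl 1%:M.
Definition PGL2_mul (g h : PGL2) : PGL2 := pgl (mat g *m mat h).
Definition PGL2_inv (g : PGL2) : PGL2 := pgl (invmx (mat g)).

Lemma pglM_subproof M N : M \in unitmx -> N \in unitmx ->
  pgl (M *m N) = PGL2_mul (pgl M) (pgl N).
Proof.
move=> uM uN; apply/esym/pglP; rewrite ?unitmx_mul ?mat_unit ?uM //.
have [c uc ->] := mat_pgl uM; have [d ud ->] := mat_pgl uN.
exists (c * d); rewrite ?unitrM ?uc //.
by rewrite -scalemxAl -scalemxAr scalerA.
Qed.

Fact PGL2_mulA : associative PGL2_mul.
Proof.
move=> g h k; rewrite -[g]matK -[h]matK -[k]matK.
by rewrite -!pglM_subproof ?unitmx_mul ?mat_unit // mulmxA.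
Qed.
Fact PGL2_mul1g : left_id PGL2_one PGL2_mul.
Proof.
by move=> g; rewrite -[g in LHS]matK -pglM_subproof ?unitmx1 ?mat_unit //
  mul1mx matK.
Qed.
Fact PGL2_mulg1 : right_id PGL2_one PGL2_mul.
Proof.
by move=> g; rewrite -[g in LHS]matK -pglM_subproof ?unitmx1 ?mat_unit //
  mulmx1 matK.
Qed.
Fact PGL2_mulVg : left_inverse PGL2_one PGL2_inv PGL2_mul.
Proof.
move=> g; rewrite -{2}[g]matK.
by rewrite -pglM_subproof ?unitmx_inv ?mat_unit // mulVmx ?mat_unit.
Qed.
Fact PGL2_mulgV : right_inverse PGL2_one PGL2_inv PGL2_mul.
Proof.
by move=> g; rewrite -{1}[g]matK -pglM_subproof ?unitmx_inv ?mat_unit // mulmxV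
  ?mat_unit.
Qed.
HB.instance Definition _ := isGroup.Build PGL2
  PGL2_mulA PGL2_mul1g PGL2_mulg1 PGL2_mulVg PGL2_mulgV.

Lemma pgl1 : pgl 1%:M = 1%g. Proof. by []. Qed.

Lemma pglM M N : M \in unitmx -> N \in unitmx ->
  pgl (M *m N) = (pgl M * pgl N)%g.
Proof. exact: pglM_subproof. Qed.

Definition mx2 (a b c d : A) : 'M[A]_2 :=
  \matrix_(i, j) if i == 0 then if j == 0 then a else b
                 else if j == 0 then c else d.

Lemma det_mx2 a b c d : \det (mx2 a b c d) = a * d - b * c.
Proof.
rewrite (expand_det_row _ 0) !big_ord_recl big_ord0 /cofactor !det_mx11 !mxE /=.
by rewrite addr0 expr0 expr1 mul1r mulN1r mulrN.
Qed.

Definition u_ (s : A) : PGL2 := pgl (mx2 1 s 0 1).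
Definition t_ (s : A) : PGL2 := pgl (mx2 s 0 0 1).

End PGL2.

(* The subspace topology from 2 x 2 matrices is the group topology of GL_2 when
   inversion is continuous on the units of [A], as it is for F and F_eps. *)
HB.instance Definition _ (A : topComUnitRingType) :=
  Topological.copy (GL2 A)
    (initial_topology (fun M : GL2 A => \val M : 'M[A]_2)).

Section QuotientTopology.
Variable A : topComUnitRingType.

Definition PGL2_open (V : set (PGL2 A)) := open (\pi_(PGL2 A) @^-1` V).

Fact PGL2_openT : PGL2_open setT.
Proof. by rewrite /PGL2_open preimage_setT; exact: openT. Qed.
Fact PGL2_openI : setI_closed PGL2_open.
Proof. by move=> V W; exact: openI. Qed.
Fact PGL2_open_bigcup (I : Type) (V : I -> set (PGL2 A)) :
  (forall i, PGL2_open (V i)) -> PGL2_open (\bigcup_i V i).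
Proof. by move=> oV; apply: bigcup_open => i _; exact: oV. Qed.

HB.instance Definition _ := isOpenTopological.Build (PGL2 A)
  PGL2_openT PGL2_openI PGL2_open_bigcup.
End QuotientTopology.

Section Functoriality.
Variables (A B : comUnitRingType) (phi : {rmorphism A -> B}).

Definition PGL2_map (g : PGL2 A) : PGL2 B := pgl (map_mx phi (mat g)).

Lemma PGL2_mapE M : M \in unitmx -> PGL2_map (pgl M) = pgl (map_mx phi M).
Proof.
move=> uM; have umap (N : 'M[A]_2) : N \in unitmx -> map_mx phi N \in unitmx.
  by rewrite !unitmxE det_map_mx => /rmorph_unit; apply.
apply/pglP; rewrite ?umap ?mat_unit //.
have [c uc ->] := mat_pgl uM; exists (phi c); first exact: rmorph_unit.
by rewrite map_mxZ.
Qed.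
End Functoriality.

Definition locally_constant_on (T : topologicalType) (Y : Type) (D : set T)
    (f : T -> Y) : Prop :=
  forall x, D x -> \forall y \near within D (nbhs x), f y = f x.

Section Groups.
Variable F : dvFieldType.

Definition K_eps : set (PGL2 (dual F)) :=
  range (PGL2_map (dual_map (\val : integers F -> F))).

Definition G_in : PGL2 F -> PGL2 (dual F) := PGL2_map (@dual_in F).

Definition sl2 : set 'M[F]_2 := [set m | \tr m = 0].

Definition one_plus_eps (m : 'M[F]_2) : PGL2 (dual F) :=
  pgl (1%:M + eps *: map_mx (@dual_in F) m).

Definition U : set (PGL2 F) := range (@u_ F).
Definition U_ge (l : int) : set (PGL2 F) :=
  @u_ F @` [set s | (l%:E <= valuation s)%E].

Definition centralizer (m : 'M[F]_2) : set (PGL2 F) :=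
  [set g | mat g *m m *m invmx (mat g) = m].

Lemma centralizer_U : centralizer (mx2 0 1 0 0) = @U.
Proof.
set m : 'M[F]_2 := mx2 0 1 0 0.
have comm (M : 'M[F]_2) : M \in unitmx ->
    (M *m m *m invmx M = m) <-> (M *m m = m *m M).
  move=> uM; split=> [e|->]; last by rewrite mulmxK.
  by rewrite -{2}e mulmxKV.
have I2 (i : 'I_2) : i = 0 \/ i = 1.
  by case: i => [[|[|//]] i2]; [left | right]; apply/val_inj.
apply/seteqP; split=> g; rewrite /centralizer /=.
  move=> /(comm _ (mat_unit g)) /matrixP e.
  have := e 0 0; have := e 0 1.
  rewrite !mxE !big_ord_recl !big_ord0 !mxE /=.
  have -> : lift ord0 ord0 = 1 :> 'I_2 by apply/val_inj.
  rewrite !(mulr0, mul0r, mulr1, mul1r, add0r, addr0) => ad /esym c0.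
  have eM : mat g = mx2 (mat g 0 0) (mat g 0 1) 0 (mat g 0 0).
    apply/matrixP => i j; rewrite mxE.
    have [->|->] := I2 i; have [->|->] := I2 j => //=.
  have a0 : mat g 0 0 != 0.
    have := mat_unit g; rewrite eM unitmxE det_mx2 mulr0 subr0 unitfE.
    by rewrite mulf_eq0 orbb mxE.
  exists (mat g 0 1 / mat g 0 0) => //; rewrite -[RHS]matK.
  apply/pglP; rewrite ?mat_unit ?unitmxE ?det_mx2 ?mul1r ?mulr0 ?subr0 ?unitr1 //.
  exists (mat g 0 0)^-1; first by rewrite unitrV unitfE.
  apply/matrixP => i j; rewrite [in RHS]eM !mxE.
  have [->|->] := I2 i; have [->|->] := I2 j => //=; rewrite ?mulVf ?mulr0 //.
  by rewrite mulrC.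
move=> [s _ <-]; apply/(comm _ (mat_unit _)).
have [|c _ ->] := @mat_pgl F (mx2 1 s 0 1).
  by rewrite unitmxE det_mx2 mul1r mulr0 subr0 unitr1.
rewrite -scalemxAl -scalemxAr; congr (_ *: _); apply/matrixP => i j.
rewrite !mxE !big_ord_recl !big_ord0 !mxE /=.
have [->|->] := I2 i; have [->|->] := I2 j => //=;
  by rewrite !(mulr0, mul0r, mulr1, mul1r, add0r, addr0).
Qed.

Definition U_rel : rel (PGL2 F) := fun g h =>
  `[< exists2 w, U w & h = (w * g)%g >].

Lemma u_0 : u_ (0 : F) = 1%g.
Proof.
congr pgl; apply/matrixP => i j; rewrite !mxE.
by case: i j => [[|[]]//] ? [[|[]]//] ?.
Qed.

Lemma u_D (s s' : F) : u_ (s + s') = (u_ s * u_ s')%g.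
Proof.
rewrite /u_ -pglM ?det_mx2 ?unitmxE ?det_mx2 ?mul1r ?mulr0 ?subr0 ?unitr1 //.
congr pgl; apply/matrixP => i j.
rewrite !mxE !big_ord_recl big_ord0 !mxE /=.
case: i j => [[|[]]//] ? [[|[]]//] ? /=;
  by rewrite !(mul1r, mulr1, mul0r, mulr0, addr0, add0r) // addrC.
Qed.

Fact U_refl : reflexive U_rel.
Proof.
move=> g; apply/asboolP; exists 1%g; last by rewrite mul1g.
by exists 0 => //; exact: u_0.
Qed.
Fact U_trans : transitive U_rel.
Proof.
move=> h g k /asboolP[_ [s _ <-] ->] /asboolP[_ [s' _ <-] ->].
apply/asboolP; exists (u_ (s' + s)); first by exists (s' + s).
by rewrite u_D mulgA.
Qed.
Fact U_imp g h : U_rel g h -> U_rel h g.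
Proof.
move=> /asboolP[_ [s _ <-] ->]; apply/asboolP.
exists (u_ (- s)); first by exists (- s).
by rewrite mulgA -u_D addNr u_0 mul1g.
Qed.
Fact U_sym : symmetric U_rel.
Proof. by move=> g h; apply/idP/idP => /U_imp. Qed.

Canonical U_equiv := EquivRel U_rel U_refl U_sym U_trans.

(* The space U\G of orbits of left translation by U. *)
Definition U_orbits : Type := quotient_topology {eq_quot U_rel}.
HB.instance Definition _ := Quotient.on U_orbits.
HB.instance Definition _ := Topological.on U_orbits.

End Groups.

Section Representation.
Variables (R : realType) (F : localFieldType).
Local Notation C := R[i].
Local Notation G := (PGL2 F).
Local Notation Ge := (PGL2 (dual F)).

Definition additive_character (psi0 : F -> C) : Prop :=
  [/\ forall x y, psi0 (x + y) = psi0 x * psi0 y,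
      forall x, `|psi0 x| = 1 &
      locally_constant_on setT psi0].

(* Only the values of [psi] on the subgroup [H] matter. *)
Definition character (H : set G) (psi : G -> C) : Prop :=
  [/\ forall g h, H g -> H h -> psi (g * h)%g = psi g * psi h,
      forall g, H g -> psi g != 0 &
      locally_constant_on H psi].

Definition trivial_on (H : set G) (psi : G -> C) : Prop :=
  forall g, H g -> psi g = 1.

(* The set below has a least element for every nontrivial character of U, so
   the default value of [xget] is never used on characters. *)
Definition conductor (psi : G -> C) : \bar int :=
  if `[< trivial_on (@U F) psi >] then -oo%E
  else (xget 0 [set l : int | trivial_on (U_ge l) psi /\
                  forall l' : int, trivial_on (U_ge l') psi -> l <= l'])%:E.

(* The support is the nonvanishing locus, closed as f is locally constant. *)
Definition V (psi0 : F -> C) (m : 'M[F]_2) (psi : G -> C) : set (Ge -> C) :=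
  [set f | [/\ locally_constant_on setT f,
      forall m' g, sl2 m' ->
        f (one_plus_eps m' * G_in g)%g = psi0 (\tr (m *m m')) * f (G_in g),
      forall w g, U w -> f (G_in (w * g)%g) = psi w * f (G_in g) &
      compact ((\pi_(U_orbits F) : G -> U_orbits F) @`
                 [set g | f (G_in g) != 0])]].

Definition right_translate (g : Ge) (f : Ge -> C) : Ge -> C :=
  fun h => f (h * g)%g.

Definition invariants (H : set Ge) (W : set (Ge -> C)) : set (Ge -> C) :=
  [set f | W f /\ forall k, H k -> right_translate k f = f].

Definition q : C := #|` fset_set [set: residue_field F] |%:R.

Definition double_coset (H : set Ge) (g : Ge) : set Ge :=
  [set (k * g * k')%g | k in H & k' in H].

Definition left_coset (g : Ge) (H : set Ge) : set Ge :=
  [set (g * k)%g | k in H].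

Definition hecke_elt (pi xt : integers F) : Ge :=
  t_ ((\val pi, \val xt) : dual F).

(* [T_x] on right [K_eps]-invariant functions, for a lift [xt] of [x]; the
   summand does not depend on the point [xget 1 c] chosen in the coset [c]. *)
Definition hecke (pi xt : integers F) (f : Ge -> C) : Ge -> C := fun h =>
  q^-1 *
  \sum_(c \in [set c : set Ge | exists g, c = left_coset g (@K_eps F) /\
                 c `<=` double_coset (@K_eps F) (hecke_elt pi xt)])
     right_translate (xget 1%g c) f h.

End Representation.

(* Main.v *)
Require Import Defs.
From HB Require Import structures.
From mathcomp Require Import all_boot all_order all_algebra.
From mathcomp Require Import finmap complex ring.
From mathcomp Require Import all_classical all_reals topology.

Import Order.TTheory GRing.Theory Num.Theory.

Local Open Scope classical_set_scope.
Local Open Scope quotient_scope.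
Local Open Scope ring_scope.

(* Put P = O_eps / (pi + eps x).  The left K_eps-cosets in K_eps g_x K_eps are
   indexed by the projective line over P: q^2 cosets of upper triangular
   matrices [[pi + eps x, s], [0, 1]] with s in P, and q cosets of lower
   triangular matrices [[1, 0], [t, pi + eps x]] with t in the maximal ideal of
   P, which is the image of eps O.  After left translation by t_{pi^-r}, an
   upper representative becomes (1 + eps n) u_s t_{pi^(1-r)} with n of lower left
   entry 0 and v(s) >= -r, so f takes the value f(t_{pi^(1-r)}) because psi is
   trivial on U_(-r).  A lower representative becomes (1 + eps n) t_{pi^(-r-1)}
   with n of lower left entry in pi^r O, contained in O, where psi_0 is trivial. *)

(** * Two-by-two matrices and the maps induced on PGL_2 by ring morphisms *)

Lemma ord2P (i : 'I_2) : i = 0 \/ i = 1.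
Proof. by case: i => [[|[|//]] i2]; [left | right]; apply/val_inj. Qed.

Lemma mx2_eta (A : comUnitRingType) (M : 'M[A]_2) :
  M = mx2 (M 0 0) (M 0 1) (M 1 0) (M 1 1).
Proof.
apply/matrixP => i j; rewrite mxE.
by have [->|->] := ord2P i; have [->|->] := ord2P j.
Qed.

Lemma mx2_inj (A : comUnitRingType) (a b c d a' b' c' d' : A) :
  mx2 a b c d = mx2 a' b' c' d' -> [/\ a = a', b = b', c = c' & d = d'].
Proof.
move=> /matrixP e; move: (e 0 0) (e 0 1) (e 1 0) (e 1 1).
by rewrite !mxE.
Qed.

Lemma mul_mx2 (A : comUnitRingType) (a b c d a' b' c' d' : A) :
  mx2 a b c d *m mx2 a' b' c' d' =
  mx2 (a * a' + b * c') (a * b' + b * d') (c * a' + d * c') (c * b' + d * d').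
Proof.
apply/matrixP => i j; rewrite !mxE !big_ord_recl big_ord0 !mxE addr0.
by have [->|->] := ord2P i; have [->|->] := ord2P j.
Qed.

Lemma scale_mx2 (A : comUnitRingType) (k a b c d : A) :
  k *: mx2 a b c d = mx2 (k * a) (k * b) (k * c) (k * d).
Proof.
apply/matrixP => i j; rewrite !mxE.
by have [->|->] := ord2P i; have [->|->] := ord2P j.
Qed.

Lemma map_mx2 (A B : comUnitRingType) (h : A -> B) (a b c d : A) :
  map_mx h (mx2 a b c d) = mx2 (h a) (h b) (h c) (h d).
Proof.
apply/matrixP => i j; rewrite !mxE.
by have [->|->] := ord2P i; have [->|->] := ord2P j.
Qed.

Lemma unitmx2 (A : comUnitRingType) (a b c d : A) :
  (mx2 a b c d \in unitmx) = (a * d - b * c \is a GRing.unit).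
Proof. by rewrite unitmxE det_mx2. Qed.

Lemma rmorph_unitmx {A B : comUnitRingType} (phi : {rmorphism A -> B}) (M : 'M_2) :
  M \in unitmx -> map_mx phi M \in unitmx.
Proof. by rewrite !unitmxE det_map_mx; exact: rmorph_unit. Qed.

Lemma PGL2_mapM {A B : comUnitRingType} (phi : {rmorphism A -> B}) (g h : PGL2 A) :
  PGL2_map phi (g * h)%g = (PGL2_map phi g * PGL2_map phi h)%g.
Proof.
rewrite -[in LHS](matK g) -[in LHS](matK h) -pglM ?mat_unit //.
by rewrite PGL2_mapE ?unitmx_mul ?mat_unit // map_mxM pglM ?rmorph_unitmx ?mat_unit.
Qed.

Lemma PGL2_map1 {A B : comUnitRingType} (phi : {rmorphism A -> B}) :
  PGL2_map phi 1%g = 1%g.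
Proof. by rewrite -pgl1 PGL2_mapE ?unitmx1 // map_mx1. Qed.

Lemma range_PGL2_mapP {A B : comUnitRingType} (phi : {rmorphism A -> B}) (g : PGL2 B) :
  range (PGL2_map phi) g <->
  exists2 N : 'M[A]_2, N \in unitmx & g = pgl (map_mx phi N).
Proof.
split=> [[k _ <-]|[N uN ->]].
  by exists (mat k); rewrite ?mat_unit.
by exists (pgl N); rewrite ?PGL2_mapE.
Qed.

(** * The group K_eps and its left cosets *)

Definition ival {F : dvFieldType} : {rmorphism dual (integers F) -> dual F} :=
  dual_map (\val : integers F -> F).

(** This form makes the results on [range (PGL2_map phi)], for a general ring morphism [phi],
    available for [K_eps]. *)
Lemma K_epsE (F : dvFieldType) : @K_eps F = range (PGL2_map (@ival F)).
Proof. reflexivity. Qed.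

Lemma K_epsP {F : dvFieldType} (g : PGL2 (dual F)) :
  K_eps g <-> exists2 N : 'M[dual (integers F)]_2, N \in unitmx &
                g = pgl (map_mx ival N).
Proof. by rewrite K_epsE; exact: range_PGL2_mapP. Qed.

Lemma K_eps1 {F : dvFieldType} : @K_eps F 1%g.
Proof. by rewrite K_epsE; exists 1%g; rewrite ?PGL2_map1. Qed.

Lemma K_epsM {F : dvFieldType} (g h : PGL2 (dual F)) :
  K_eps g -> K_eps h -> K_eps (g * h)%g.
Proof.
rewrite K_epsE => -[k _ <-] [l _ <-].
by exists (k * l)%g; rewrite ?PGL2_mapM.
Qed.

Lemma K_epsV {F : dvFieldType} (g : PGL2 (dual F)) : K_eps g -> K_eps g^-1%g.
Proof.
rewrite K_epsE => -[k _ <-]; exists k^-1%g; first by [].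
by apply: (mulgI (PGL2_map ival k)); rewrite -PGL2_mapM !mulgV PGL2_map1.
Qed.

Lemma subgroup_coset_eqP {G : groupType} (H : set G) (g h : G) :
  H 1%g -> (forall k l, H k -> H l -> H (k * l)%g) ->
  (forall k, H k -> H k^-1%g) ->
  [set (g * k)%g | k in H] = [set (h * k)%g | k in H] <->
  exists2 k, H k & h = (g * k)%g.
Proof.
move=> H1 HM HV; split=> [e|[k Hk ->]].
  have : [set (h * k)%g | k in H] h by exists 1%g; rewrite ?mulg1.
  by rewrite -e => -[k Hk <-]; exists k.
apply/seteqP; split=> _ [l Hl <-].
  exists (k^-1 * l)%g; first by apply: HM; first exact: HV.
  by rewrite mulgA mulgK.
by exists (k * l)%g; [exact: HM | rewrite mulgA].
Qed.

(** A coset inside H a H contains its own representative k a l, and l is absorbed by H on the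
    right. *)
Lemma subgroup_coset_sub_double {G : groupType} (H : set G) (a : G) :
  H 1%g -> (forall k l, H k -> H l -> H (k * l)%g) ->
  (forall k, H k -> H k^-1%g) ->
  [set c | exists g, c = [set (g * k)%g | k in H] /\
           c `<=` [set (k * a * k')%g | k in H & k' in H]] =
  [set [set (k * a * l)%g | l in H] | k in H].
Proof.
move=> H1 HM HV; apply/seteqP; split=> [_ [g [-> sub]]|_ [k Hk <-]].
  have [|k Hk [l Hl e]] := sub g; first by exists 1%g; rewrite ?mulg1.
  by exists k => //; apply/subgroup_coset_eqP => //; exists l.
exists (k * a)%g; split=> // _ [l Hl <-].
by exists k => //; exists l.
Qed.

Lemma left_coset_eqP {F : localFieldType} (g h : PGL2 (dual F)) :
  left_coset g (@K_eps F) = left_coset h (@K_eps F) <->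
  exists2 k, K_eps k & h = (g * k)%g.
Proof.
exact: (subgroup_coset_eqP (@K_eps F) g h K_eps1 (@K_epsM F) (@K_epsV F)).
Qed.

Lemma left_coset_sub_double {F : localFieldType} (a : PGL2 (dual F)) :
  [set c : set _ | exists g, c = left_coset g (@K_eps F) /\
                   c `<=` double_coset (@K_eps F) a] =
  [set left_coset (k * a)%g (@K_eps F) | k in @K_eps F].
Proof.
exact: (subgroup_coset_sub_double (@K_eps F) a K_eps1 (@K_epsM F) (@K_epsV F)).
Qed.

(** * The maximal ideal and uniformizers *)

Lemma max_idealP {F : dvFieldType} (x : integers F) :
  (x \in max_ideal) = (x \isn't a GRing.unit).
Proof.
rewrite !unfold_in /= /integers_unit /max_ideal lt_neqAle integersP andbT eq_sym.
by [].
Qed.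

Lemma residue_eqP {F : dvFieldType} (pi : integers F) (x y : integers F) :
  uniformizer pi ->
  \pi_(residue_field F) x = \pi_(residue_field F) y <->
  exists z, x - y = pi * z.
Proof.
move=> /seteqP[h h']; split.
  move=> /eqP; rewrite -Quotient.idealrBE => xy.
  by have [z _ <-] := h _ xy; exists z.
move=> [z e]; apply/eqP; rewrite -Quotient.idealrBE e.
by apply: h'; exists z.
Qed.

(** The maximal ideal is not zero, because it contains an element of valuation 1. *)
Lemma uniformizer_neq0 {F : dvFieldType} (pi : integers F) :
  uniformizer pi -> pi != 0.
Proof.
move=> /seteqP[h _]; apply/eqP => pi0; have [x vx] := val_norm (s := F).
have xO : x \in integral by rewrite unfold_in vx.
have [|z _] := h (Sub x xO); first by rewrite /= unfold_in /= vx.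
rewrite pi0 mul0r => /(congr1 val) /= x0; move: vx.
by rewrite -x0 val0.
Qed.

Lemma uniformizer_nunit {F : dvFieldType} (pi z : integers F) :
  uniformizer pi -> pi * z \isn't a GRing.unit.
Proof. by move=> /seteqP[_ h]; rewrite -max_idealP; apply: h; exists z. Qed.

Lemma ival_inj (F : dvFieldType) : injective (@ival F).
Proof. by move=> [a b] [c d] [/val_inj -> /val_inj ->]. Qed.

Lemma dual_unitE (A : comUnitRingType) (x : dual A) :
  (x \is a GRing.unit) = (x.1 \is a GRing.unit).
Proof. by []. Qed.

(** * Coset representatives of determinant p, over a general ring morphism *)

Definition upper_rep {A B : comUnitRingType} (phi : {rmorphism A -> B}) (p s : A) :
  PGL2 B := pgl (map_mx phi (mx2 p s 0 1)).

Definition lower_rep {A B : comUnitRingType} (phi : {rmorphism A -> B}) (p t : A) :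
  PGL2 B := pgl (map_mx phi (mx2 1 0 t p)).

Lemma upper_rep_unit {A B : comUnitRingType} (phi : {rmorphism A -> B}) (p s : A) :
  phi p \is a GRing.unit -> map_mx phi (mx2 p s 0 1) \in unitmx.
Proof. by move=> up; rewrite unitmxE det_map_mx det_mx2 mulr1 mulr0 subr0. Qed.

Lemma lower_rep_unit {A B : comUnitRingType} (phi : {rmorphism A -> B}) (p t : A) :
  phi p \is a GRing.unit -> map_mx phi (mx2 1 0 t p) \in unitmx.
Proof. by move=> up; rewrite unitmxE det_map_mx det_mx2 mul1r mul0r subr0. Qed.

(** Invertibility is asked of the images only: a matrix of determinant [p] becomes invertible over
    [B] as soon as [phi p] is a unit, even if [p] is not one. *)
Lemma pgl_map_mulmx {A B : comUnitRingType} (phi : {rmorphism A -> B})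
    (M N : 'M[A]_2) :
  map_mx phi M \in unitmx -> map_mx phi N \in unitmx ->
  (pgl (map_mx phi M) * pgl (map_mx phi N))%g = pgl (map_mx phi (M *m N)).
Proof. by move=> uM uN; rewrite map_mxM pglM. Qed.

Lemma upper_rep_in {A B : comUnitRingType} (phi : {rmorphism A -> B}) (p s : A) :
  phi p \is a GRing.unit ->
  exists2 k, range (PGL2_map phi) k & upper_rep phi p s = (k * upper_rep phi p 0)%g.
Proof.
move=> up; have uN : mx2 1 s 0 1 \in unitmx.
  by rewrite unitmx2 mulr0 subr0 mulr1 unitr1.
exists (pgl (map_mx phi (mx2 1 s 0 1))).
  by apply/range_PGL2_mapP; exists (mx2 1 s 0 1).
rewrite /upper_rep pgl_map_mulmx ?(upper_rep_unit phi p _ up) ?rmorph_unitmx // mul_mx2.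
by congr (pgl (map_mx _ (mx2 _ _ _ _))); ring.
Qed.

Lemma lower_rep_in {A B : comUnitRingType} (phi : {rmorphism A -> B}) (p t : A) :
  phi p \is a GRing.unit ->
  exists2 k, range (PGL2_map phi) k & exists2 l, range (PGL2_map phi) l &
  (k * upper_rep phi p 0 = lower_rep phi p t * l)%g.
Proof.
move=> up.
have uN (t' : A) : mx2 0 1 1 t' \in unitmx.
  by rewrite unitmx2 mulr1 mul0r sub0r unitrN1.
(* The Weyl element exchanges diag(p, 1) and diag(1, p). Both sides of the equation are the class of
   [[0, 1], [p, t]]. *)
exists (pgl (map_mx phi (mx2 0 1 1 t))).
  by apply/range_PGL2_mapP; exists (mx2 0 1 1 t).
exists (pgl (map_mx phi (mx2 0 1 1 0))).
  by apply/range_PGL2_mapP; exists (mx2 0 1 1 0).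
rewrite /upper_rep /lower_rep.
rewrite !pgl_map_mulmx ?(upper_rep_unit phi p _ up) ?(lower_rep_unit phi p _ up)
  ?rmorph_unitmx // !mul_mx2.
by congr (pgl (map_mx _ (mx2 _ _ _ _))); ring.
Qed.

(** With N the matrix of a, b, c, d, the factor [l] is the quotient [[p, s], [0, 1]]^-1 N diag(p,
    1). Its upper right entry (b - s d) / p is the integral element z, and its determinant is that
    of N. *)
Lemma mul_upper_rep {A B : comUnitRingType} (phi : {rmorphism A -> B})
    (p s z a b c d : A) :
  phi p \is a GRing.unit -> mx2 a b c d \in unitmx -> b = s * d + p * z ->
  exists2 l, range (PGL2_map phi) l &
    (pgl (map_mx phi (mx2 a b c d)) * upper_rep phi p 0 = upper_rep phi p s * l)%g.
Proof.
move=> up uN eb; have uk : mx2 (a - s * c) z (c * p) d \in unitmx.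
  by move: uN; rewrite !unitmx2 eb; congr (_ \is a _); ring.
exists (pgl (map_mx phi (mx2 (a - s * c) z (c * p) d))).
  by apply/range_PGL2_mapP; exists (mx2 (a - s * c) z (c * p) d).
rewrite /upper_rep !pgl_map_mulmx ?(upper_rep_unit phi p _ up) ?rmorph_unitmx //.
rewrite !mul_mx2 eb.
by congr (pgl (map_mx _ (mx2 _ _ _ _))); ring.
Qed.

(** Here the quotient is [[1, 0], [t, p]]^-1 N diag(p, 1), whose lower right entry is (d - t b) / p
    = z. Its determinant is again that of N. *)
Lemma mul_lower_rep {A B : comUnitRingType} (phi : {rmorphism A -> B})
    (p t z a b c d : A) :
  phi p \is a GRing.unit -> mx2 a b c d \in unitmx -> d = t * b + p * z ->
  exists2 l, range (PGL2_map phi) l &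
    (pgl (map_mx phi (mx2 a b c d)) * upper_rep phi p 0 = lower_rep phi p t * l)%g.
Proof.
move=> up uN ed; have uk : mx2 (p * a) b (c - t * a) z \in unitmx.
  by move: uN; rewrite !unitmx2 ed; congr (_ \is a _); ring.
exists (pgl (map_mx phi (mx2 (p * a) b (c - t * a) z))).
  by apply/range_PGL2_mapP; exists (mx2 (p * a) b (c - t * a) z).
rewrite /upper_rep /lower_rep !pgl_map_mulmx ?(upper_rep_unit phi p _ up)
  ?(lower_rep_unit phi p _ up) ?rmorph_unitmx //.
by rewrite !mul_mx2 ed; congr (pgl (map_mx _ (mx2 _ _ _ _))); ring.
Qed.

Lemma pgl_map_eq_mul {A B : comUnitRingType} (phi : {rmorphism A -> B})
    (M M' : 'M[A]_2) (l : PGL2 B) :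
  map_mx phi M \in unitmx -> map_mx phi M' \in unitmx ->
  range (PGL2_map phi) l -> pgl (map_mx phi M') = (pgl (map_mx phi M) * l)%g ->
  exists c a1 b1 a2 b2, [/\ mx2 a1 b1 a2 b2 \in unitmx &
    map_mx phi M' = c *: map_mx phi (M *m mx2 a1 b1 a2 b2)].
Proof.
move=> uM uM' /range_PGL2_mapP[N uN ->].
rewrite pgl_map_mulmx ?(rmorph_unitmx phi N uN) // => /pglP[//||c _ e].
  by rewrite map_mxM unitmx_mul uM (rmorph_unitmx phi N uN).
by exists c, (N 0 0), (N 0 1), (N 1 0), (N 1 1); rewrite -mx2_eta; split.
Qed.

(** Up to the projective scalar k, the second rows give k (phi c, phi d) = (0, 1). So c = 0, d is a
    unit, and eliminating k from the upper right entries gives s' d = s d + p b, an equation over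
    [A] since [phi] is injective. *)
Lemma upper_rep_eq {A B : comUnitRingType} (phi : {rmorphism A -> B})
    (p s s' : A) (l : PGL2 B) :
  injective phi -> phi p \is a GRing.unit -> range (PGL2_map phi) l ->
  upper_rep phi p s' = (upper_rep phi p s * l)%g -> exists z, s' = s + p * z.
Proof.
move=> phi_inj up Kl /pgl_map_eq_mul[] //; try exact: upper_rep_unit.
move=> k [a [b [c [d [uN]]]]].
rewrite mul_mx2 !map_mx2 scale_mx2 !mul0r !add0r !mul1r rmorph0 rmorph1.
move=> /mx2_inj[_ es ec ed].
have c0 : c = 0.
  apply: phi_inj; rewrite rmorph0 -[LHS]mul1r ed.
  by rewrite -mulrA [phi d * _]mulrC mulrA -ec mul0r.
move: uN; rewrite unitmx2 c0 mulr0 subr0 unitrM => /andP[_ ud].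
have esd : s' * d = p * b + s * d.
  by apply: phi_inj; rewrite rmorphM es mulrAC -ed mul1r.
exists (b / d); apply: (mulIr ud); rewrite esd; rewrite mulrDl -!mulrA mulVr //.
by rewrite mulr1 addrC.
Qed.

Lemma lower_rep_eq {A B : comUnitRingType} (phi : {rmorphism A -> B})
    (p t t' : A) (l : PGL2 B) :
  injective phi -> phi p \is a GRing.unit -> range (PGL2_map phi) l ->
  lower_rep phi p t' = (lower_rep phi p t * l)%g -> exists z, t' = t + p * z.
Proof.
move=> phi_inj up Kl /pgl_map_eq_mul[] //; try exact: lower_rep_unit.
move=> k [a [b [c [d [uN]]]]].
rewrite mul_mx2 !map_mx2 scale_mx2 !mul0r !addr0 !mul1r rmorph0 rmorph1.
move=> /mx2_inj[ea eb et _].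
have b0 : b = 0.
  apply: phi_inj; rewrite rmorph0 -[LHS]mul1r ea.
  by rewrite -mulrA [phi a * _]mulrC mulrA -eb mul0r.
move: uN; rewrite unitmx2 b0 mul0r subr0 unitrM => /andP[ua _].
have eta : t' * a = t * a + p * c.
  by apply: phi_inj; rewrite rmorphM et mulrAC -ea mul1r.
exists (c / a); apply: (mulIr ua); rewrite eta; rewrite mulrDl -!mulrA mulVr //.
by rewrite mulr1.
Qed.

(** With w = p a + s c, the first column and the lower right entry force the second row (c, d) of
    the invertible matrix to be (t w, p w). Its determinant a d - b c is then a unit in the ideal
    generated by t and p. *)
Lemma upper_lower_rep_eq {A B : comUnitRingType} (phi : {rmorphism A -> B})
    (p s t : A) (l : PGL2 B) :
  injective phi -> phi p \is a GRing.unit -> range (PGL2_map phi) l ->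
  lower_rep phi p t = (upper_rep phi p s * l)%g ->
  exists x y, x * t + y * p \is a GRing.unit.
Proof.
move=> phi_inj up Kl /pgl_map_eq_mul[] //.
- exact: upper_rep_unit.
- exact: lower_rep_unit.
move=> k [a [b [c [d [uN]]]]].
rewrite mul_mx2 !map_mx2 scale_mx2 !mul0r !add0r !mul1r rmorph0 rmorph1.
move=> /mx2_inj[e1 _ et ep].
have ec : c = t * (p * a + s * c).
  by apply: phi_inj; rewrite rmorphM et mulrAC -e1 mul1r.
have ed : d = p * (p * a + s * c).
  by apply: phi_inj; rewrite rmorphM ep mulrAC -e1 mul1r.
exists (- b * (p * a + s * c)), (a * (p * a + s * c)).
move: uN; rewrite unitmx2 {1}ed {2}ec; congr (_ \is a _); ring.
Qed.

(** * Representatives modulo pi, and of O_eps modulo pi + eps xt *)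

Lemma residue_repr (F : dvFieldType) (pi : integers F) (y : integers F) :
  uniformizer pi -> exists (a : residue_field F) z, y = repr a + pi * z.
Proof.
move=> hpi; exists (\pi_(residue_field F) y).
have /(residue_eqP pi y (repr (\pi_(residue_field F) y)) hpi)[z e] :
  \pi_(residue_field F) y = \pi_(residue_field F) (repr (\pi_(residue_field F) y)).
  by rewrite reprK.
by exists z; rewrite -e addrC subrK.
Qed.

Lemma residue_repr_inj (F : dvFieldType) (pi z : integers F)
    (a b : residue_field F) :
  uniformizer pi -> repr a = repr b + pi * z -> a = b.
Proof.
move=> hpi e; rewrite -[a]reprK -[b]reprK; apply/(residue_eqP _ _ _ hpi).
by exists z; rewrite e addrC addKr.
Qed.

Lemma hecke_eltE {F : localFieldType} (pi xt : integers F) :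
  hecke_elt pi xt = upper_rep (@ival F) (pi, xt) 0.
Proof. by rewrite /upper_rep map_mx2 rmorph0 rmorph1. Qed.

Lemma val_integers_eq0 {F : dvFieldType} (x : integers F) :
  (\val x == 0) = (x == 0).
Proof. by apply/eqP/eqP => [e|->]; [apply: val_inj|]. Qed.

Lemma ival_unit {F : dvFieldType} (pi xt : integers F) :
  pi != 0 -> ival ((pi, xt) : dual (integers F)) \is a GRing.unit.
Proof.
by move=> p0; rewrite dual_unitE /= unitfE val_integers_eq0.
Qed.

Lemma integers_mulI {F : dvFieldType} (x y : integers F) :
  x != 0 -> x * y = 0 -> y = 0.
Proof.
move=> x0 /(congr1 val) /= /eqP; rewrite mulf_eq0 !val_integers_eq0.
by rewrite (negPf x0) => /eqP.
Qed.

(** A system of representatives of O_eps modulo pi + eps xt, the same for every xt. *)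
Definition dual_lift {F : dvFieldType} (ab : residue_field F * residue_field F) :
  dual (integers F) := (repr ab.1, repr ab.2).

(** Representatives of the non-units of O_eps modulo pi + eps xt: the first coordinate of a non-unit
    is a multiple of pi, so it can be reduced to 0. *)
Definition eps_lift {F : dvFieldType} (a : residue_field F) :
  dual (integers F) := (0, repr a).

(* The casts of [(pi, xt)] matter: without them [*] is the componentwise product. *)
Lemma dual_liftP {F : dvFieldType} (pi xt : integers F) (y : dual (integers F)) :
  uniformizer pi -> exists ab z, y = dual_lift ab + ((pi, xt) : dual (integers F)) * z.
Proof.
case: y => y1 y2 hpi.
have [a [z1 e1]] := residue_repr _ pi y1 hpi.
(* Multiplying z1 + eps z2 by pi + eps xt puts xt z1 into the second coordinate, so this term is
   removed before reducing modulo pi. *)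
have [b [z2 e2]] := residue_repr _ pi (y2 - xt * z1) hpi.
exists (a, b), (z1, z2); congr (_, _); rewrite /= -?e1 //.
by rewrite addrA -e2 subrK.
Qed.

(** Comparing first coordinates modulo pi gives a = a', hence pi z1 = 0 and z1 = 0. The mixed term
    xt z1 then vanishes and the second coordinates can be compared modulo pi too. *)
Lemma dual_lift_inj {F : dvFieldType} (pi xt : integers F) ab ab' z :
  uniformizer pi ->
  dual_lift ab = dual_lift ab' + ((pi, xt) : dual (integers F)) * z -> ab = ab'.
Proof.
case: ab ab' z => a b [a' b'] [z1 z2] hpi [/= ea eb].
have aa := residue_repr_inj _ _ _ _ _ hpi ea; rewrite aa in ea *.
have z10 : z1 = 0.
  apply: integers_mulI (uniformizer_neq0 _ hpi) _.
  by apply: (addrI (repr a')); rewrite -ea addr0.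
rewrite z10 mulr0 addr0 in eb.
by rewrite (residue_repr_inj _ _ _ _ _ hpi eb).
Qed.

Lemma eps_liftP {F : dvFieldType} (pi xt : integers F) (y : dual (integers F)) :
  uniformizer pi -> y \isn't a GRing.unit ->
  exists a z, y = eps_lift a + ((pi, xt) : dual (integers F)) * z.
Proof.
case: y => y1 y2 hpi; rewrite dual_unitE -max_idealP /=.
have /seteqP[h _] := hpi; move=> /h[z1 _ e1].
have [b [z2 e2]] := residue_repr _ pi (y2 - xt * z1) hpi.
exists b, (z1, z2); congr (_, _); rewrite /= ?add0r -?e1 //.
by rewrite addrA -e2 subrK.
Qed.

Lemma eps_lift_inj {F : dvFieldType} (pi xt : integers F) a a' z :
  uniformizer pi ->
  eps_lift a = eps_lift a' + ((pi, xt) : dual (integers F)) * z -> a = a'.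
Proof.
case: z => z1 z2 hpi [/= e1 eb].
have z10 : z1 = 0.
  apply: integers_mulI (uniformizer_neq0 _ hpi) _; apply: val_inj => /=.
  by rewrite [RHS]e1 add0r.
rewrite z10 mulr0 addr0 in eb.
by rewrite (residue_repr_inj _ _ _ _ _ hpi eb).
Qed.

(** * Decomposition of the double coset into left cosets *)

Lemma hecke_coset_cover {F : localFieldType} (pi xt : integers F) k :
  uniformizer pi -> K_eps k ->
  (exists ab, left_coset (k * hecke_elt pi xt)%g (@K_eps F) =
     left_coset (upper_rep (@ival F) (pi, xt) (dual_lift ab)) (@K_eps F)) \/
  (exists a, left_coset (k * hecke_elt pi xt)%g (@K_eps F) =
     left_coset (lower_rep (@ival F) (pi, xt) (eps_lift a)) (@K_eps F)).
Proof.
move=> hpi /K_epsP[N uN ->]; rewrite hecke_eltE.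
have up := ival_unit pi xt (uniformizer_neq0 _ hpi).
move: uN; rewrite (mx2_eta _ N).
move: (N 0 0) (N 0 1) (N 1 0) (N 1 1) => a b c d uN.
(* The second column (b, d) of N, as a point of the projective line, determines the coset: b / d
   indexes an upper representative, d / b a lower one. *)
have [ud|nd] := boolP (d \is a GRing.unit).
  left; have [ab [z e]] := dual_liftP pi xt (b / d) hpi; exists ab.
  have eb : b = dual_lift ab * d + ((pi, xt) : dual (integers F)) * (z * d).
    by rewrite mulrA -mulrDl -e divrK.
  have [l Kl el] := mul_upper_rep (@ival F) _ _ _ _ _ _ _ up uN eb.
  by apply/esym/left_coset_eqP; exists l; rewrite ?K_epsE.
(* If b were a non-unit as well, the first coordinates of b and d, hence that of the determinant,
   would be multiples of pi. *)
have ub : b \is a GRing.unit.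
  apply: contraT; rewrite dual_unitE -max_idealP.
  move: nd; rewrite dual_unitE -max_idealP.
  have /seteqP[h _] := hpi; move=> /h[d' _ ed] /h[b' _ eb].
  move: uN; rewrite unitmx2 dual_unitE /= -ed -eb mulrCA -mulrA -mulrBr.
  by rewrite (negPf (uniformizer_nunit _ _ hpi)).
right; have nt : d / b \isn't a GRing.unit by rewrite unitrMl ?unitrV.
have [t [z e]] := eps_liftP pi xt (d / b) hpi nt; exists t.
have ed : d = eps_lift t * b + ((pi, xt) : dual (integers F)) * (z * b).
  by rewrite mulrA -mulrDl -e divrK.
have [l Kl el] := mul_lower_rep (@ival F) _ _ _ _ _ _ _ up uN ed.
by apply/esym/left_coset_eqP; exists l; rewrite ?K_epsE.
Qed.

Lemma hecke_cosets {F : localFieldType} (pi xt : integers F) :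
  uniformizer pi ->
  [set c : set (PGL2 (dual F)) | exists g, c = left_coset g (@K_eps F) /\
     c `<=` double_coset (@K_eps F) (hecke_elt pi xt)] =
  [set left_coset (upper_rep (@ival F) (pi, xt) (dual_lift ab)) (@K_eps F)
     | ab in setT] `|`
  [set left_coset (lower_rep (@ival F) (pi, xt) (eps_lift a)) (@K_eps F)
     | a in setT].
Proof.
move=> hpi; have up := ival_unit pi xt (uniformizer_neq0 _ hpi).
rewrite left_coset_sub_double; apply/seteqP; split=> [_ [k Kk <-]|_ [] [a _ <-]].
- have [[a e]|[a e]] := hecke_coset_cover pi xt k hpi Kk.
    by left; exists a; [exact: I | exact: esym e].
  by right; exists a; [exact: I | exact: esym e].
- have [k Kk e] := upper_rep_in (@ival F) (pi, xt) (dual_lift a) up.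
  exists k; first by rewrite K_epsE.
  by rewrite hecke_eltE -e.
have [k Kk [l Kl e]] := lower_rep_in (@ival F) (pi, xt) (eps_lift a) up.
exists k; first by rewrite K_epsE.
apply/esym/left_coset_eqP; exists l; first by rewrite K_epsE.
rewrite hecke_eltE; exact: e.
Qed.

Lemma upper_coset_inj {F : localFieldType} (pi xt : integers F) :
  uniformizer pi ->
  injective (fun ab => left_coset (upper_rep (@ival F) (pi, xt) (dual_lift ab))
                         (@K_eps F)).
Proof.
move=> hpi ab ab' /esym/left_coset_eqP[k Kk e].
have up := ival_unit pi xt (uniformizer_neq0 _ hpi).
rewrite K_epsE in Kk.
have [z ez] := upper_rep_eq (@ival F) _ _ _ _ (@ival_inj F) up Kk e.
exact: dual_lift_inj hpi ez.
Qed.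

Lemma lower_coset_inj {F : localFieldType} (pi xt : integers F) :
  uniformizer pi ->
  injective (fun a => left_coset (lower_rep (@ival F) (pi, xt) (eps_lift a))
                        (@K_eps F)).
Proof.
move=> hpi a a' /esym/left_coset_eqP[k Kk e].
have up := ival_unit pi xt (uniformizer_neq0 _ hpi).
rewrite K_epsE in Kk.
have [z ez] := lower_rep_eq (@ival F) _ _ _ _ (@ival_inj F) up Kk e.
exact: eps_lift_inj hpi ez.
Qed.

(** Equality would make some combination of eps [repr a] and pi + eps xt a unit, but its first
    coordinate is a multiple of pi. *)
Lemma upper_lower_coset_neq {F : localFieldType} (pi xt : integers F) s a :
  uniformizer pi ->
  left_coset (upper_rep (@ival F) (pi, xt) s) (@K_eps F) <>
  left_coset (lower_rep (@ival F) (pi, xt) (eps_lift a)) (@K_eps F).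
Proof.
move=> hpi /left_coset_eqP[k Kk e].
have up := ival_unit pi xt (uniformizer_neq0 _ hpi).
rewrite K_epsE in Kk.
have [x [y]] := upper_lower_rep_eq (@ival F) _ _ _ _ (@ival_inj F) up Kk e.
rewrite dual_unitE /= mulr0 add0r mulrC.
by rewrite (negPf (uniformizer_nunit _ _ hpi)).
Qed.

(** * Finite sums and the value of the Hecke operator *)

Lemma fsum_const {R : nzSemiRingType} {T : choiceType} (A : set T) (c : R) :
  finite_set A -> \sum_(i \in A) c = #|` fset_set A|%:R * c.
Proof.
move=> fA; rewrite fsbig_finite // big_const_seq count_predT iter_addr_0.
by rewrite mulr_natl.
Qed.

Lemma card_fset_setX {T U : choiceType} (A : set T) (B : set U) :
  finite_set A -> finite_set B ->
  #|` fset_set (A `*` B)| = (#|` fset_set A| * #|` fset_set B|)%N.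
Proof.
move=> fA fB; have := fsum_const (A `*` B) 1%N (finite_setX fA fB).
rewrite -(pair_fsbig _ (fun _ _ => 1%N) fA fB) !fsum_const //.
by rewrite !mulr1 !natn => <-.
Qed.

Lemma fsum_image_const {R : nzSemiRingType} {I J : choiceType} (A : set I)
    (h : I -> J) (F : J -> R) (c : R) :
  finite_set A -> injective h -> (forall i, F (h i) = c) ->
  \sum_(j \in [set h i | i in A]) F j = #|` fset_set A|%:R * c.
Proof.
move=> fA hI Fh; rewrite fsbig_image; last by move=> x y _ _; exact: hI.
transitivity (\sum_(i \in A) c); first exact: eq_fsbigr.
exact: fsum_const.
Qed.

Lemma residue_card_neq0 (R : realType) (F : localFieldType) : q R F != 0.
Proof.
rewrite /q pnatr_eq0 cardfs_eq0; apply/negP => /eqP e.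
have : (0 : residue_field F) \in fset_set [set: residue_field F].
  by rewrite in_fset_set ?inE //; exact: residue_finite.
by rewrite e inE.
Qed.

(** The q^2 upper cosets contribute q^2 a and the q lower cosets q b; the normalization q^-1 leaves
    q a + b. *)
Lemma hecke_value {R : realType} {F : localFieldType} (pi xt : integers F)
    (f : PGL2 (dual F) -> R[i]) (h : PGL2 (dual F)) (a b : R[i]) :
  uniformizer pi ->
  (forall k, K_eps k -> right_translate k f = f) ->
  (forall s, f (h * upper_rep (@ival F) (pi, xt) (dual_lift s))%g = a) ->
  (forall t, f (h * lower_rep (@ival F) (pi, xt) (eps_lift t))%g = b) ->
  hecke pi xt f h = q R F * a + b.
Proof.
move=> hpi fK fa fb; rewrite /hecke hecke_cosets //.
have finT : finite_set [set: residue_field F] by exact: residue_finite.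
have finTT : finite_set [set: residue_field F * residue_field F].
  by rewrite -setXTT; exact: finite_setX.
(* Cosets are nonempty, so [xget] returns a point g k of the coset, and invariance of [f] removes
   k. *)
have fxget g : right_translate (xget 1%g (left_coset g (@K_eps F))) f h = f (h * g)%g.
  have [k Kk e] : left_coset g (@K_eps F) (xget 1%g (left_coset g (@K_eps F))).
    apply: (@xgetPex _ 1%g (left_coset g (@K_eps F))); exists g.
    by exists 1%g; [exact: K_eps1 | rewrite mulg1].
  by rewrite /right_translate -e mulgA -[in RHS](fK k Kk).
rewrite fsbigU0; [|exact: finite_image..|]; last first.
  by move=> _ [[s _ <-] [t _ /esym]]; exact: upper_lower_coset_neq.
rewrite (fsum_image_const _ _ _ a finTT (upper_coset_inj pi xt hpi)); last first.
  by move=> s; rewrite fxget; exact: fa.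
rewrite (fsum_image_const _ _ _ b finT (lower_coset_inj pi xt hpi)); last first.
  by move=> t; rewrite fxget; exact: fb.
rewrite -setXTT card_fset_setX // natrM.
by rewrite -/(q R F) mulrDr !mulrA mulVf ?residue_card_neq0 // !mul1r.
Qed.

(** * Characters of U and their conductor *)

Lemma nbhs_valuation {F : dvFieldType} (P : set F) :
  nbhs (0 : F) P -> exists n : int, forall s : F, (n%:E <= valuation s)%E -> P s.
Proof.
rewrite -filter_from_entourageE => -[A /val_entourage[n nA] AP].
by exists n => s ns; apply: AP; rewrite /xsection /= inE; apply: nA; rewrite subr0.
Qed.

(** Pulled back to GL_2 and then to matrices, a neighbourhood of 1 contains a box given by one
    condition per entry. Along u_s only the upper right entry varies, so a bound on the valuation of
    s suffices. *)
Lemma u_nbhs {F : dvFieldType} (W : set (PGL2 F)) : nbhs (1%g : PGL2 F) W ->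
  exists n : int, forall s : F, (n%:E <= valuation s)%E -> W (u_ s).
Proof.
have uM (s : F) : mx2 1 s 0 1 \in unitmx.
  by rewrite unitmx2 mulr0 subr0 mulr1 unitr1.
rewrite nbhsE => -[V' [oV V1] VW].
have [B oB BV] : open ((\pi_(PGL2 F) @^-1` V') : set (GL2 F)) by exact: oV.
have VB s : V' (u_ s) <-> B (mx2 1 s 0 1).
  have -> : V' (u_ s) = (\pi_(PGL2 F) @^-1` V') (insubd (GL2_one F) (mx2 1 s 0 1)) by [].
  rewrite -BV -[X in _ <-> B X](insubdK (GL2_one F) (uM s)).
  by split.
have /VB B1 : V' (u_ 0) by rewrite u_0.
have [P P1 PB] : nbhs (mx2 1 0 0 1 : 'M[F]_2) B by exact: open_nbhs_nbhs.
have [n nP] : exists n : int, forall s : F, (n%:E <= valuation s)%E -> P 0 1 s.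
  by apply: nbhs_valuation; have := P1 0 1; rewrite mxE.
exists n => s /nP ps; apply/VW/VB/PB => i j.
have := nbhs_singleton (P1 i j).
by have [->|->] := ord2P i; have [->|->] := ord2P j; rewrite !mxE.
Qed.

Lemma trivial_on_U_ge {R : realType} {F : localFieldType} (psi : PGL2 F -> R[i]) :
  character (@U F) psi -> exists n : int, trivial_on (U_ge n) psi.
Proof.
move=> [psiM psi0 psi_lc].
have U1 : @U F 1%g by exists 0; rewrite ?u_0.
have psi1 : psi 1%g = 1.
  apply: (mulfI (psi0 _ U1)); rewrite mulr1 -psiM //.
  by rewrite mulg1.
have /u_nbhs[n np] := psi_lc _ U1.
exists n => _ [s /= ns <-]; rewrite np ?psi1 //.
by exists s.
Qed.

(** Translation by the lower bound [b] reduces this to the least element of a nonempty set of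
    natural numbers. *)
Lemma int_min_exists (P : set int) (l b : int) :
  P l -> (forall n, P n -> b <= n) ->
  exists2 m, P m & forall n, P n -> m <= n.
Proof.
move=> Pl bP.
have bE n : P n -> b + (absz (n - b)%R)%:Z = n.
  by move=> Pn; rewrite gez0_abs ?subr_ge0 ?bP // addrCA subrr addr0.
have exP : exists k : nat, `[< P (b + k%:Z) >].
  by exists (absz (l - b)%R); apply/asboolP; rewrite bE.
case: (ex_minnP exP) => k /asboolP Pk kmin; exists (b + k%:Z) => // n Pn.
rewrite -(bE n Pn) lerD2l lez_nat; apply: kmin; apply/asboolP.
by rewrite bE.
Qed.

(** For nontrivial [psi] a least level must be exhibited before [xget] can be trusted. Some level
    exists because [psi] is locally constant, and the levels are bounded below by the valuation of
    any s at which [psi] is not 1. Triviality then passes from U_(c) to its subset U_(-r), as c <=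
    -r. *)
Lemma conductor_trivial {R : realType} {F : localFieldType}
    (psi : PGL2 F -> R[i]) (r : int) :
  character (@U F) psi -> (r%:E <= - conductor psi)%E ->
  trivial_on (U_ge (- r)) psi.
Proof.
move=> psi_char; have [n tn] := trivial_on_U_ge psi psi_char.
rewrite /conductor; case: asboolP => [tU _ _ [s _ <-]|ntU]; first by apply: tU; exists s.
set S := [set l | _].
have [m Sm] : exists m, S m.
  have /existsNP[_ /not_implyP[[s _ <-] ps]] := ntU.
  have s0 : s != 0.
    by apply: contra_notN ps => /eqP ->; apply: tn; exists 0; rewrite /= ?val0 ?leey.
  have /fineK sE := val_fin s s0.
  have [|m tm mP] := int_min_exists [set l | trivial_on (U_ge l) psi] n
    (fine (valuation s)) tn.
    move=> l tl; rewrite leNgt; apply/negP => ls; apply: ps; apply: tl.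
    by exists s => //=; rewrite -sE lee_fin ltW.
  by exists m; split.
rewrite -EFinN lee_fin lerNr => rc.
have [tc _] : S (xget 0 S) by apply: (@xgetPex _ 0 S); exists m.
move=> _ [s /= rs <-]; apply: tc; exists s => //=.
by apply: le_trans rs; rewrite lee_fin.
Qed.

(** * Arithmetic of dual numbers and valuations of powers *)

Lemma dual_mulE {A : comNzRingType} (x y : dual A) :
  x * y = (x.1 * y.1, x.1 * y.2 + x.2 * y.1) :> dual A.
Proof. by []. Qed.

Lemma dual_addE {A : comNzRingType} (x y : dual A) :
  x + y = (x.1 + y.1, x.2 + y.2) :> dual A.
Proof. by []. Qed.

(** The valuation of [pi] is positive, and it is at most 1 because [pi] divides an element of
    valuation 1. *)
Lemma val_uniformizer {F : dvFieldType} (pi : integers F) :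
  uniformizer pi -> valuation (\val pi) = 1%:E.
Proof.
move=> hpi; have p0 := uniformizer_neq0 _ hpi; have /seteqP[h _] := hpi.
have vp : (0 < valuation (\val pi))%E.
  have : pi \in max_ideal by rewrite max_idealP -[pi]mulr1; exact: uniformizer_nunit.
  by [].
have [x vx] := val_norm (s := F).
have xO : x \in integral by rewrite unfold_in vx.
have [|z _ /(congr1 val) /= e] := h (Sub x xO); first by rewrite /= unfold_in /= vx.
have vp1 : (valuation (\val pi) <= 1%:E)%E.
  by rewrite -vx -e Defs.valM leeDl //; exact: integersP.
move: vp vp1; case: (valuation (\val pi)) => [v| |] //.
by rewrite lte_fin lee_fin => v0 v1; congr (_%:E); apply/eqP; rewrite eq_le v1.
Qed.

Lemma val_expz {F : dvFieldType} (x : F) (n : int) :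
  valuation x = 1%:E -> valuation (x ^ n) = n%:E.
Proof.
move=> vx; have x0 : x != 0 by apply/eqP => /valE0; rewrite vx.
have vn (k : nat) : valuation (x ^+ k) = (k%:Z)%:E.
  elim: k => [|k IH]; first by rewrite expr0 Defs.val1.
  by rewrite exprS Defs.valM IH vx -EFinD -intS.
case: n => k; first exact: vn.
have := Defs.val1 F; rewrite -[1 in LHS](@divff _ (x ^+ k.+1)) ?expf_neq0 // Defs.valM vn.
rewrite NegzE -[x ^ (- _)]/((x ^+ k.+1)^-1).
case: (valuation (_^-1)) => [v| |] //.
by rewrite -EFinD => -[] /eqP; rewrite addrC addr_eq0 => /eqP ->.
Qed.

(** * Factorization of elements of G_eps through 1 + eps M_2 and G *)

Lemma one_plus_eps_mx2 {F : dvFieldType} (a b c d : F) :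
  one_plus_eps (mx2 a b c d) =
  pgl (mx2 ((1, a) : dual F) ((0, b) : dual F) ((0, c) : dual F) ((1, d) : dual F)).
Proof.
have dE (u w : F) : dual_in u + eps * dual_in w = (u, w) :> dual F.
  by rewrite [RHS]dualE.
rewrite /one_plus_eps; congr pgl; apply/matrixP => i j; rewrite !mxE.
rewrite -!dE rmorph1 rmorph0.
by have [->|->] := ord2P i; have [->|->] := ord2P j.
Qed.

Lemma G_in_mx2 {F : dvFieldType} (a b c d : F) : mx2 a b c d \in unitmx ->
  G_in (pgl (mx2 a b c d)) =
  pgl (mx2 (dual_in a) (dual_in b) (dual_in c) (dual_in d)).
Proof. by move=> u; rewrite /G_in (PGL2_mapE _ u) map_mx2. Qed.

Lemma one_plus_eps_unit {F : dvFieldType} (a b c d : F) :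
  mx2 ((1, a) : dual F) ((0, b) : dual F) ((0, c) : dual F) ((1, d) : dual F)
    \in unitmx.
Proof. by rewrite unitmx2 dual_unitE /= mulr1 mulr0 subr0 unitr1. Qed.

(* In PGL_2 the infinitesimal part of an element of [1 + eps M_2] is only
   defined up to scalars, so in characteristic not 2 it can be made traceless. *)
Lemma one_plus_eps_traceless {F : dvFieldType} (a b c d : F) :
  2%:R != 0 :> F ->
  one_plus_eps (mx2 a b c d) =
  one_plus_eps (mx2 ((a - d) / 2%:R) b c ((d - a) / 2%:R)).
Proof.
move=> two; rewrite !one_plus_eps_mx2.
apply/pglP; rewrite ?one_plus_eps_unit //.
exists ((1, (a + d) / 2%:R) : dual F); first by rewrite dual_unitE unitr1.
by rewrite scale_mx2; congr mx2; rewrite dual_mulE; congr (_, _) => /=; field.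
Qed.

(** This extends the equivariance from sl_2 to all of M_2. Passing to the traceless part keeps the
    lower left entry, and that entry is the trace of the product with m. *)
Lemma V_one_plus_eps {R : realType} {F : localFieldType} (psi0 : F -> R[i])
    (psi : PGL2 F -> R[i]) (f : PGL2 (dual F) -> R[i]) (a b c d : F) (g : PGL2 F) :
  2%:R != 0 :> F -> V psi0 (mx2 0 1 0 0) psi f ->
  f (one_plus_eps (mx2 a b c d) * G_in g)%g = psi0 c * f (G_in g).
Proof.
move=> two [_ Vm _ _]; rewrite one_plus_eps_traceless //.
have trE (a' b' c' d' : F) : \tr (mx2 a' b' c' d') = a' + d'.
  by rewrite /mxtrace !big_ord_recl big_ord0 !mxE /= addr0.
have tr0 : sl2 (mx2 ((a - d) / 2%:R) b c ((d - a) / 2%:R)).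
  rewrite /sl2 /= trE.
  by field.
have trm : \tr (mx2 0 1 0 0 *m mx2 ((a - d) / 2%:R) b c ((d - a) / 2%:R)) = c.
  rewrite mul_mx2 trE.
  by ring.
have := Vm _ g tr0.
rewrite trm.
exact: id.
Qed.

Lemma pgl_mul_mx2 {A : comUnitRingType} (a b c d a' b' c' d' : A) :
  a * d - b * c \is a GRing.unit -> a' * d' - b' * c' \is a GRing.unit ->
  (pgl (mx2 a b c d) * pgl (mx2 a' b' c' d'))%g =
  pgl (mx2 (a * a' + b * c') (a * b' + b * d') (c * a' + d * c') (c * b' + d * d')).
Proof. by move=> u u'; rewrite -pglM ?unitmx2 // mul_mx2. Qed.

Lemma pgl_mulmx_eq {A : comUnitRingType} (M N M' N' : 'M[A]_2) :
  M \in unitmx -> N \in unitmx -> M' \in unitmx -> N' \in unitmx ->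
  M *m N = M' *m N' -> (pgl M * pgl N = pgl M' * pgl N')%g.
Proof. by move=> uM uN uM' uN' e; rewrite -!pglM // e. Qed.

Lemma upper_rep_ivalE {F : dvFieldType} (p s : dual (integers F)) :
  upper_rep (@ival F) p s =
  pgl (mx2 ((\val p.1, \val p.2) : dual F) ((\val s.1, \val s.2) : dual F) 0 1).
Proof. by rewrite /upper_rep map_mx2 rmorph0 rmorph1. Qed.

Lemma lower_rep_ivalE {F : dvFieldType} (p s : dual (integers F)) :
  lower_rep (@ival F) p s =
  pgl (mx2 1 0 ((\val s.1, \val s.2) : dual F) ((\val p.1, \val p.2) : dual F)).
Proof. by rewrite /lower_rep map_mx2 rmorph0 rmorph1. Qed.

(** A matrix A + eps B with A invertible is (1 + eps B A^-1) A. Here A = [[P pi, P s1], [0, 1]] is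
    u_{P s1} t_{P pi}, and B = [[P xt, P s2], [0, 0]], so the second row of B A^-1 is 0. *)
Lemma t_mul_upper_rep {F : dvFieldType} (pi xt : integers F)
    (P : F) (s : dual (integers F)) :
  pi != 0 -> P != 0 ->
  (G_in (t_ P) * upper_rep (@ival F) (pi, xt) s)%g =
  (one_plus_eps (mx2 (\val xt / \val pi)
     (P * \val s.2 - P * \val xt * \val s.1 / \val pi) 0 0) *
   G_in (u_ (P * \val s.1) * t_ (P * \val pi)))%g.
Proof.
move=> p0 P0.
have vp0 : \val pi != 0 by rewrite val_integers_eq0.
rewrite upper_rep_ivalE.
move: (\val pi) (\val xt) (\val s.1) (\val s.2) vp0 => p x s1 s2 vp0.
have uP : P \is a GRing.unit by rewrite unitfE.
have uPp : P * p \is a GRing.unit by rewrite unitfE mulf_neq0.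
have -> : (u_ (P * s1) * t_ (P * p))%g = pgl (mx2 (P * p) (P * s1) 0 1).
  rewrite /u_ /t_ pgl_mul_mx2; last 2 first.
  - by rewrite mulr1 mulr0 subr0 unitr1.
  - by rewrite mulr1 mulr0 subr0.
  by rewrite !mulr0 !mulr1 !mul1r !mul0r !addr0 !add0r.
rewrite one_plus_eps_mx2 /t_ G_in_mx2; last by rewrite unitmx2 mulr1 mulr0 subr0.
rewrite G_in_mx2; last by rewrite unitmx2 mulr1 mulr0 subr0.
apply: pgl_mulmx_eq.
- by rewrite unitmx2 dual_unitE /= mulr1 mulr0 subr0.
- by rewrite unitmx2 dual_unitE /= mulr1 mulr0 subr0 unitfE.
- by rewrite unitmx2 dual_unitE /= mulr1 mulr0 subr0 unitr1.
- by rewrite unitmx2 dual_unitE /= mulr1 mulr0 subr0.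
rewrite !mul_mx2; congr mx2; rewrite !dual_mulE !dual_addE /=; congr (_, _).
all: by field; rewrite ?vp0 ?P0.
Qed.

(** The same factorization with A = diag(P, pi) and B = [[0, 0], [c, xt]]. In PGL_2, A is t_{P / pi}
    after division by the scalar pi. *)
Lemma t_mul_lower_rep {F : dvFieldType} (pi xt : integers F)
    (P : F) (c : integers F) :
  pi != 0 -> P != 0 ->
  (G_in (t_ P) * lower_rep (@ival F) (pi, xt) (0, c))%g =
  (one_plus_eps (mx2 0 0 (\val c / P) (\val xt / \val pi)) *
   G_in (t_ (P / \val pi)))%g.
Proof.
move=> p0 P0.
have vp0 : \val pi != 0 by rewrite val_integers_eq0.
rewrite lower_rep_ivalE.
move: (\val pi) (\val xt) (\val c) vp0 => p x s1 vp0.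
have uP : P \is a GRing.unit by rewrite unitfE.
have uPp : P / p \is a GRing.unit by rewrite unitfE mulf_neq0 ?invr_neq0.
have up : p \is a GRing.unit by rewrite unitfE.
have uPp' : P * p \is a GRing.unit by rewrite unitfE mulf_neq0.
have -> : t_ (P / p) = pgl (mx2 P 0 0 p).
  apply/pglP; [by rewrite unitmx2 mulr1 mulr0 subr0|by rewrite unitmx2 mulr0 subr0|].
  exists p^-1; first by rewrite unitrV.
  by rewrite scale_mx2 mulr0 mulVf // mulrC.
rewrite one_plus_eps_mx2 /t_ G_in_mx2; last by rewrite unitmx2 mulr1 mulr0 subr0.
rewrite G_in_mx2; last by rewrite unitmx2 mulr0 subr0.
apply: pgl_mulmx_eq.
- by rewrite unitmx2 dual_unitE /= mulr1 mulr0 subr0.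
- by rewrite unitmx2 dual_unitE /= mul1r mul0r subr0 unitfE.
- by rewrite unitmx2 dual_unitE /= mulr1 mulr0 subr0 unitr1.
- by rewrite unitmx2 dual_unitE /= mulr0 subr0.
rewrite !mul_mx2; congr mx2; rewrite !dual_mulE !dual_addE /=; congr (_, _).
all: by field; rewrite ?vp0 ?P0.
Qed.

Theorem claim4p22 (R : realType) (F : localFieldType)
  (charF : 2%N \notin [pchar F])
  (pi : integers F) (pi_unif : uniformizer pi)
  (psi0 : F -> R[i]) (psi0_char : additive_character psi0)
  (psi0_O : [set x : F | forall y : integers F, psi0 (x * \val y) = 1] =
            [set x : F | x \in integral])
  (psi : PGL2 F -> R[i]) (psi_char : character (@U F) psi)
  (x : residue_field F) (xt : integers F) (xt_lift : \pi_(residue_field F) xt = x)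
  (r : int) (r_ge0 : 0 <= r) (r_le : (r%:E <= - conductor psi)%E)
  (f : PGL2 (dual F) -> R[i])
  (f_inv : invariants (@K_eps F) (V psi0 (mx2 0 1 0 0) psi) f) :
  hecke pi xt f (G_in (t_ (\val pi ^ (- r)))) =
    q R F * f (G_in (t_ (\val pi ^ (- (r - 1))))) +
    f (G_in (t_ (\val pi ^ (- (r + 1))))).
Proof.
have [Vf fK] := f_inv.
have two : 2%:R != 0 :> F by move: charF; rewrite inE.
have p0 := uniformizer_neq0 _ pi_unif.
have vp0 : \val pi != 0 by rewrite val_integers_eq0.
have vpi := val_uniformizer pi pi_unif.
have P0 : \val pi ^ (- r) != 0 by rewrite expfz_neq0.
have P_pred : \val pi ^ (- r) * \val pi = \val pi ^ (- (r - 1)).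
  by rewrite opprB [1 - r]addrC expfzDr // expr1z.
have P_succ : \val pi ^ (- r) / \val pi = \val pi ^ (- (r + 1)).
  by rewrite opprD expfzDr.
(* Since 1 is integral, the hypothesis on [psi0] can be read at 1. *)
have psi0_int (y : integers F) : psi0 (\val y) = 1.
  have /seteqP[_ h] := psi0_O; have := h 1 _ y; rewrite mul1r; apply.
  by rewrite /= unfold_in Defs.val1.
have psi_triv := conductor_trivial psi r psi_char r_le.
apply: (hecke_value pi xt f (G_in (t_ (\val pi ^ (- r)))) _ _ pi_unif fK) => [s|t].
- apply: etrans (congr1 f (t_mul_upper_rep pi xt _ (dual_lift s) p0 P0)) _.
  apply: etrans (V_one_plus_eps psi0 psi f _ _ _ _ _ two Vf) _.
  (* The infinitesimal factor has lower left entry 0, so it contributes psi_0(0) = 1. *)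
  have := psi0_int 0; rewrite /= => ->; rewrite mul1r.
  have [_ _ VU _] := Vf.
  have sU : U_ge (- r) (u_ (\val pi ^ (- r) * \val (dual_lift s).1)).
    exists (\val pi ^ (- r) * \val (dual_lift s).1); last by [].
    by rewrite /= Defs.valM val_expz // leeDl //; exact: integersP.
  apply: etrans (VU _ _ _) _.
    by exists (\val pi ^ (- r) * \val (dual_lift s).1).
  by rewrite (psi_triv _ sU) mul1r -P_pred.
apply: etrans (congr1 f (t_mul_lower_rep pi xt _ (repr t) p0 P0)) _.
apply: etrans (V_one_plus_eps psi0 psi f _ _ _ _ _ two Vf) _.
(* The assumption 0 <= r enters here: it makes the lower left entry [repr t] pi^r integral, and the
   natural exponent allows it to be written inside O. *)
have -> : \val (repr t) / \val pi ^ (- r) = \val (repr t * pi ^+ `|r|%N).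
  rewrite invr_expz opprK rmorphM rmorphXn /=.
  by rewrite -[r in LHS]gez0_abs.
by rewrite psi0_int mul1r -P_succ.
Qed.
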